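(* Let $(Q,w,\mathcal C,K)$ be a two-way-comparison decision tree instance (as defined in the context). If the instance is feasible (i.e., at least one two-way-comparison decision tree for it exists), then some minimum-cost two-way-comparison decision tree for the instance is admissible.
   Context: An instance $(Q,w,\mathcal C,K)$ consists of a totally ordered finite set $Q$ of queries, each with a weight $w(q)\ge 0$; a collection $\mathcal C\subseteq 2^Q$ of classes (each class has a unique identifier); and a set $K\subseteq Q$ of keys. Every query is assumed to belong to some class. A two-way-comparison decision tree (2WCDT) is a rooted binary tree in which each non-leaf node is a test of the form ''$q<k$'' for some $k\in K$ with $\min Q<k\le\max Q$, or ''$q=k$'' for some $k\in K$; its two children are labeled by the outcomes yes/no. Each leaf is labeled with one class in $\mathcal C$, and this class must contain every query whose search ends at that leaf. The search for $q\in Q$ starts at the root and recursively goes to the yes-subtree if $q$ satisfies the test and to the no-subtree otherwise, ending at a leaf; $q$ reaches every node on this path, and the depth of $q$ is the number of tests on the path. The cost of the tree is $\sum_{q\in Q} w(q)\cdot\mathrm{depth}(q)$. The query set $Q_u$ of a node $u$ is the set of queries reaching $u$. For $\ell,r\in Q$, $[\ell,r]=\{q\in Q:\ell\le q\le r\}$. Tie-breaking: fix an ordering of $Q$ by increasing weight, breaking ties arbitrarily, and let $\tilde w(q)$ be the rank of $q$ in this order; $q$ is lighter than $q'$ if $\tilde w(q)<\tilde w(q')$ and heavier otherwise. For $R\subseteq Q$ and integer $i\ge 0$, $\mathrm{heaviest}_i(R)$ is the set of the $i$ heaviest elements of $R$ (all of $R$ if $i\ge|R|$). For $q\in Q$,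 $\mathrm{lighter}(q)$ is the set of queries lighter than $q$. For nonempty $R\subseteq Q$: $k^*(R)$ is the heaviest key in $R$ (undefined, $\bot$, if $R\cap K=\emptyset$, with $\tilde w(\bot)=-\infty$ and $\mathrm{lighter}(\bot)=\emptyset$); the holes of $R$ are $\mathrm{holes}(R)=[\min R,\max R]\setminus R$; a hole $h$ is light if $\tilde w(h)<\tilde w(k^*(R))$. A set $R\subseteq Q$ is admissible if it is nonempty and its set of light holes is either empty or equals $\mathrm{heaviest}_b\big((K\cap[\min R,\max R]\cap \mathrm{lighter}(k^*(R)))\setminus c\big)$ for some $b\in\{1,2,3\}$ and some $c\in\mathcal C$ with $k^*(R)\in c$. A tree is admissible if the query set of each of its nodes is admissible. *)

(* Defs.v *)
From mathcomp Require Import all_boot all_order all_algebra.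

Set Implicit Arguments.
Unset Strict Implicit.
Unset Printing Implicit Defensive.

Import Order.TTheory GRing.Theory Num.Theory.

(* Queries range over a nonempty finite total order [Q : finTBOrderType d],   *)
(* so that min Q and max Q are [\bot] and [\top].  A class is identified      *)
(* with the set of queries it contains.                                       *)

Section Trees.
Context {d : Order.disp_t} {Q : finTBOrderType d}.
Implicit Types (C : {set {set Q}}) (K U : {set Q}) (q k : Q).

Inductive test := Less (k : Q) | Equal (k : Q).

Inductive tree :=
| Leaf (c : {set Q})
| Node (t : test) (yes no : tree).

Definition satisfies (t : test) q : bool :=
  match t with
  | Less k => (q < k)%O
  | Equal k => q == k
  end.

Definition allowed K (t : test) : bool :=
  match t with
  | Less k => (k \in K) && (\bot < k <= \top)%O
  | Equal k => k \in K
  end.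

(* [U] is the set of queries that reach the root of [T]. *)
Fixpoint well_formed C K U (T : tree) : bool :=
  match T with
  | Leaf c => (c \in C) && (U \subset c)
  | Node t T1 T2 =>
      [&& allowed K t,
          well_formed C K [set q in U | satisfies t q] T1 &
          well_formed C K [set q in U | ~~ satisfies t q] T2]
  end.

Definition decision_tree C K (T : tree) : bool := well_formed C K [set: Q] T.

Fixpoint depth (T : tree) q : nat :=
  match T with
  | Leaf _ => 0
  | Node t T1 T2 => (depth (if satisfies t q then T1 else T2) q).+1
  end.

(* The query sets of all the nodes of [T], when [U] reaches its root. *)
Fixpoint query_sets U (T : tree) : seq {set Q} :=
  match T with
  | Leaf _ => [:: U]
  | Node t T1 T2 =>
      U :: query_sets [set q in U | satisfies t q] T1
        ++ query_sets [set q in U | ~~ satisfies t q] T2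
  end.

End Trees.

Arguments test {d} Q.
Arguments tree {d} Q.

Section Cost.
Context {R : realFieldType} {d : Order.disp_t} {Q : finTBOrderType d}.
Implicit Types (w : Q -> R) (C : {set {set Q}}) (K : {set Q}).
Local Open Scope ring_scope.

Definition cost w (T : tree Q) : R := \sum_(q : Q) w q * (depth T q)%:R.

Definition minimum_cost w C K (T : tree Q) : Prop :=
  decision_tree C K T /\
  forall T' : tree Q, decision_tree C K T' -> cost w T <= cost w T'.

(* [s] lists Q by increasing weight, ties being broken arbitrarily. *)
Definition weight_ordering w (s : seq Q) : bool :=
  perm_eq s (enum Q) && sorted (fun p q => w p <= w q) s.

End Cost.

Section Admissible.
Context {d : Order.disp_t} {Q : finTBOrderType d}.
Variables (s : seq Q) (C : {set {set Q}}) (K : {set Q}).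
Implicit Types (U : {set Q}) (q : Q).

Definition wrank q : nat := (index q s).+1.

(* The [i] heaviest elements of [U]: those with fewer than [i] heavier ones. *)
Definition heaviest (i : nat) U : {set Q} :=
  [set q in U | #|[set p in U | wrank q < wrank p]| < i].

(* [k^*(U)], with [None] standing for the undefined key. *)
Definition kstar U : option Q :=
  [pick k in U :&: K | [forall q in U :&: K, wrank q <= wrank k]].

(* An undefined key has rank -oo: no query is lighter than it. *)
Definition lighter (k : option Q) : {set Q} :=
  if k is Some k0 then [set q | wrank q < wrank k0] else set0.

(* [min U, max U]; only meaningful when [U] is nonempty. *)
Definition hull U : {set Q} :=
  [set q | (\big[Order.min / \top]_(p in U) p <= q
              <= \big[Order.max / \bot]_(p in U) p)%O].

Definition holes U : {set Q} := hull U :\: U.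

Definition light_holes U : {set Q} := holes U :&: lighter (kstar U).

Definition admissible U : Prop :=
  U != set0 /\
  (light_holes U = set0 \/
   exists (b : nat) (c : {set Q}) (k : Q),
     [/\ 1 <= b <= 3, c \in C, kstar U = Some k, k \in c &
         light_holes U =
           heaviest b ((K :&: hull U :&: lighter (kstar U)) :\: c)]).

Definition admissible_tree (T : tree Q) : Prop :=
  forall U, U \in query_sets [set: Q] T -> admissible U.

End Admissible.

(* Main.v *)
(* Perturbing the weights by a small multiple of the rank makes them positive
   and strictly increasing in the rank, without creating new minimum-cost trees.
   For such weights every minimum-cost tree is admissible.

   A light hole [h] of a query set [V] must have been removed by a test [= h] at
   some node [v] above [V].  If a query [k] heavier than [h] reaches [v], then no
   test below [v] separates [h] from [k]: otherwise the separating test could be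
   pulled up to [v] and [= h] pushed down, which gains for [k] at least what it
   costs for [h], and nobody else loses.  So all queries at [v] heavier than [h]
   end in the same leaf, and the class of that leaf avoids [h], else [= h] could
   be replaced by [= k].  Hence the light holes are the heaviest keys of their
   range outside that class.

   There are at most three of them because the heavier key [k] has depth at most
   three below [v].  With four tests [= h], [t2], [t3], [t4] on the path of [k],
   testing [= k] at [v] shows that the weight W of the queries at [v] is at least
   [4 w k].  Splitting first by a comparison that leaves two of [h], [t2], [t3],
   [k] on each side gives either [w k <= w h], or [2 w k <= 2 w h], or
   [W <= 4 w h], each of which contradicts [w h < w k]. *)

Require Import Defs.
From mathcomp Require Import all_boot all_order all_algebra.
From mathcomp Require Import zify ring lra boolp.

Import Order.TTheory GRing.Theory Num.Theory.
Local Open Scope ring_scope.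

Set Implicit Arguments.
Unset Strict Implicit.
Unset Printing Implicit Defensive.

(** * Trees, the separation of two queries, and balanced cuts *)

Section Structure.
Context {d : Order.disp_t} {Q : finTBOrderType d}.
Implicit Types (C : {set {set Q}}) (K U V : {set Q}) (h k q : Q).
Implicit Types (t x : test Q) (T E X : tree Q).

(** Replaces the order of [Q] by that of the natural numbers, so that case analyses on the outcomes
    of tests become linear arithmetic. *)
Definition position q : nat := #|[set p : Q | (p < q)%O]|.

Lemma ltEposition p q : (p < q)%O = (position p < position q)%N.
Proof.
case: (ltP p q) => pq; apply/esym.
  apply/proper_card/properP; split.
    by apply/subsetP=> r; rewrite !inE => /lt_trans; apply.
  by exists p; rewrite !inE ?ltxx.
apply/negbTE; rewrite -leqNgt; apply/subset_leq_card/subsetP=> r.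
by rewrite !inE => /lt_le_trans; apply.
Qed.

Lemma eqEposition p q : (p == q) = (position p == position q).
Proof. by rewrite eq_le !leNgt !ltEposition -!leqNgt eqn_leq. Qed.

Fixpoint label T q : {set Q} :=
  match T with
  | Leaf c => c
  | Node t T1 T2 => label (if satisfies t q then T1 else T2) q
  end.

Fixpoint legal C K T : bool :=
  match T with
  | Leaf c => c \in C
  | Node t T1 T2 => [&& allowed K t, legal C K T1 & legal C K T2]
  end.

(** Well-formedness split into a syntactic part and a condition on single queries: a rearranged tree
    can then be checked query by query, without computing the query sets of its nodes. *)
Definition serves C K U T : bool :=
  legal C K T && [forall q in U, q \in label T q].

Lemma serves_label C K U T q : serves C K U T -> q \in U -> q \in label T q.
Proof. by case/andP=> _ /forall_inP; apply. Qed.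

Lemma servesP C K U T :
  legal C K T -> (forall q, q \in U -> q \in label T q) -> serves C K U T.
Proof. by move=> lT lab; rewrite /serves lT; apply/forall_inP. Qed.

Lemma well_formedE C K U T : well_formed C K U T = serves C K U T.
Proof.
elim: T U => [c|t T1 IH1 T2 IH2] U; rewrite /serves /=.
  by congr (_ && _); apply/subsetP/forall_inP.
rewrite IH1 IH2 /serves; set a1 := [forall _ in [set _ in _ | satisfies _ _], _].
set a2 := [forall _ in [set _ in _ | ~~ _], _].
suff ->: [forall q in U, q \in label (if satisfies t q then T1 else T2) q] = a1 && a2.
  by case: (allowed K t); case: (legal C K T1); case: a1; rewrite ?andbF ?andbT.
apply/forall_inP/andP => [a|[/forall_inP a1P /forall_inP a2P] q qU].
  by split; apply/forall_inP=> q; rewrite inE => /andP[/a]; case: ifP.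
case: ifP => sq; [apply: a1P | apply: a2P]; by rewrite inE qU sq.
Qed.

Lemma label_class C K T q : legal C K T -> label T q \in C.
Proof.
elim: T => [|t T1 IH1 T2 IH2] //= /and3P[_ l1 l2].
by case: ifP => _; [apply: IH1 | apply: IH2].
Qed.

Definition separates t k q : bool := satisfies t q != satisfies t k.

Lemma separates_id t k : separates t k k = false.
Proof. by rewrite /separates eqxx. Qed.

(* The node testing [t] whose outcome for [k] leads to [X]. *)
Definition branch t k E X : tree Q :=
  if satisfies t k then Node t X E else Node t E X.

Lemma branchE t T1 T2 k :
  Node t T1 T2 = branch t k (if satisfies t k then T2 else T1)
                            (if satisfies t k then T1 else T2).
Proof. by rewrite /branch; case: (satisfies t k). Qed.

Lemma depth_node t T1 T2 q :
  depth (Node t T1 T2) q = (if satisfies t q then depth T1 q else depth T2 q).+1.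
Proof. by rewrite /=; case: ifP. Qed.

Lemma label_node t T1 T2 q :
  label (Node t T1 T2) q = if satisfies t q then label T1 q else label T2 q.
Proof. by rewrite /=; case: ifP. Qed.

(** Induction along the search path of [k]; the subtree [E] that leaves the path at [t] is kept as a
    block. *)
Lemma path_ind k (P : tree Q -> Prop) :
  (forall c, P (Leaf c)) -> (forall t E X, P X -> P (branch t k E X)) ->
  forall T, P T.
Proof.
move=> PL PB; elim=> [|t T1 IH1 T2 IH2] //.
by rewrite (branchE t T1 T2 k); apply: PB; case: ifP.
Qed.

Lemma depth_branch t k E X q :
  depth (branch t k E X) q = (if separates t k q then depth E q else depth X q).+1.
Proof.
by rewrite /branch /separates; case: (satisfies t k) => /=;
  case: (satisfies t q).
Qed.

Lemma label_branch t k E X q :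
  label (branch t k E X) q = if separates t k q then label E q else label X q.
Proof.
by rewrite /branch /separates; case: (satisfies t k) => /=;
  case: (satisfies t q).
Qed.

Lemma legal_branch C K t k E X :
  legal C K (branch t k E X) = [&& allowed K t, legal C K E & legal C K X].
Proof.
by rewrite /branch; case: ifP => //= _; rewrite (andbC (legal _ _ E)).
Qed.

(** The queries that [t] cuts off from [k], its exit, form a ray missing [h] and [k], or a single
    query. Neither a comparison between [h] and [k] nor an equality test to one of them splits such
    a set. *)
Lemma separates_side t x h k :
  ~~ separates t k h -> separates x k h ->
  (forall q, separates t k q -> separates x k q) \/
  (forall q, separates t k q -> ~~ separates x k q).
Proof.
rewrite /separates; case: x => [m|e]; case: t => [m'|e'] /=;
  rewrite !(ltEposition, eqEposition) => th xh.
- case: (boolP (position m' <= minn (position h) (position k))%N) => hm.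
    case: (boolP (position k < position m)%N) => km; [right|left] => q;
    rewrite !ltEposition; lia.
  case: (boolP (position k < position m)%N) => km; [left|right] => q;
    rewrite !ltEposition; lia.
- case: (boolP ((position e' < position m)%N == (position k < position m)%N)) => se;
    [right|left] => q; rewrite !(ltEposition, eqEposition); lia.
- case: (boolP (position e == position k)) => se; [left|right] => q;
    rewrite !(ltEposition, eqEposition); lia.
- case: (boolP (position e == position k)) => se; [left|right] => q;
    rewrite !eqEposition; lia.
Qed.

Fixpoint separated T h k : bool :=
  match T with
  | Leaf _ => false
  | Node t T1 T2 =>
      separates t k h || separated (if satisfies t k then T1 else T2) h k
  end.

Lemma separated_branch t E X h k :
  separated (branch t k E X) h k = separates t k h || separated X h k.
Proof. by rewrite /branch; case: ifP => /= ->. Qed.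

Lemma separatedPn T h k :
  ~~ separated T h k -> label T h = label T k /\ depth T h = depth T k.
Proof.
elim/(@path_ind k): T => [|t E X IH] //.
rewrite separated_branch negb_or => /andP[/negPf th /IH[labX depX]].
by rewrite !label_branch !depth_branch th separates_id labX depX.
Qed.

(* The first test that separates [h] from [k] is pulled up to the root, and the
   equality test to [h] is pushed down past all the tests on its side: [k]
   rises by at least as much as [h] sinks, and no other query sinks. *)
Lemma pull_separator C K T h k c :
  legal C K T -> separated T h k -> h \in K -> c \in C ->
  exists (x : test Q) (S P : tree Q) (n : nat),
    let T' := branch x k S P in
    [/\ separates x k h, (0 < n)%N & legal C K T'] /\
    [/\ label T' h = c, forall q, q != h -> label T' q = label T q,
        forall q, q != h -> (depth T' q <= (depth T q).+1)%N,
        (depth T' k + n <= (depth T k).+1)%N & (depth T' h <= n.+1)%N].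
Proof.
move=> + + hK cC; elim/(@path_ind k): T => [|t E X IH] //.
rewrite separated_branch legal_branch => /and3P[lt lE lX].
case: (boolP (separates t k h)) => /= [th _ | th /(IH lX)].
  exists t, (Node (Equal h) (Leaf c) E), X, 1%N => /=.
  rewrite legal_branch /= lt hK cC lE lX; split=> //.
  rewrite !label_branch !depth_branch th separates_id /= eqxx; split=> //.
  - by move=> q qh; rewrite !label_branch /= (negPf qh).
  - by move=> q qh; rewrite !depth_branch /= (negPf qh); case: ifP.
  - by rewrite addn1.
case=> x [S [P [n [[xh n0]]]]]; rewrite legal_branch => /and3P[lx lS lP].
rewrite !label_branch !depth_branch xh separates_id => -[labh lab dep depk deph].
(* The exit of [t] lies on one side of [x], so [t] is kept on that side only. On the side of [h], it
   spares [k] a test and costs [h] one, which increments [n]; on the side of [k], [n] stays. *)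
case: (separates_side th xh) => side.
  exists x, (branch t k E S), P, n.+1; rewrite /= !legal_branch.
  rewrite lx lt lE lS lP; split=> //.
  rewrite !label_branch !depth_branch xh !separates_id (negPf th); split=> //.
  - move=> q qh; rewrite !label_branch; have := lab q qh.
    by rewrite label_branch; have := side q;
      case: (separates t k q) => [-> | _] //.
  - move=> q qh; have := dep q qh; rewrite !depth_branch.
    have := side q; case: (separates t k q) => [-> | _] //.
    by case: ifP => _ // /leqW.
  - by rewrite addnS ltnS.
exists x, S, (branch t k E P), n; rewrite /= !legal_branch.
rewrite lx lt lE lS lP; split=> //.
rewrite !label_branch !depth_branch xh !separates_id; split=> //.
- move=> q qh; rewrite !label_branch; have := lab q qh.
  rewrite label_branch; have := side q.
  by case: (separates t k q) => [/(_ isT)/negPf-> | _] //.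
- move=> q qh; have := dep q qh; rewrite !depth_branch.
  have := side q; case: (separates t k q) => [/(_ isT)/negPf-> | _] //.
  by case: ifP => _ // /leqW.
Qed.

Lemma position_bot : position (\bot%O : Q) = 0%N.
Proof. by apply/eqP; rewrite cards_eq0; apply/eqP/setP=> p; rewrite !inE ltx0. Qed.

(** The three disjuncts are the ways to leave exactly one of [h], the exit of [t] and the exit of
    [t'] together with [k]. *)
Definition balanced_cut K h k t t' y :=
  allowed K (Less y) /\
  let sep := separates (Less y) k in
  [\/ [/\ ~~ sep h, forall q, separates t k q -> sep q
        & forall q, separates t' k q -> sep q],
      [/\ sep h, forall q, separates t k q -> sep q
        & forall q, separates t' k q -> ~~ sep q] |
      [/\ sep h, forall q, separates t k q -> ~~ sep q
        & forall q, separates t' k q -> sep q]].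

Lemma balanced_cutC K h k t t' y :
  balanced_cut K h k t t' y -> balanced_cut K h k t' t y.
Proof.
case=> ay [[s s1 s2]|[s s1 s2]|[s s1 s2]]; split=> //;
  by [constructor 1 | constructor 3 | constructor 2].
Qed.

Ltac cut_at y :=
  exists y; split;
  [ rewrite /= lex1 andbT ltEposition position_bot; apply/andP; split=> //; lia
  | rewrite /= /separates /=;
    first
    [ constructor 1; split=> [|q|q]; rewrite !(ltEposition, eqEposition); lia
    | constructor 2; split=> [|q|q]; rewrite !(ltEposition, eqEposition); lia
    | constructor 3; split=> [|q|q]; rewrite !(ltEposition, eqEposition); lia]].

(** On the line, [h], [k] and the two exits are points or rays. The cut falls between the second and
    the third of them, and its threshold can be taken among [h], [k] and the keys of the two tests.
    For two equality tests, [t <> t'] makes the exits distinct points. *)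
Lemma balanced_cut_exists K h k t t' :
  h \in K -> k \in K -> h != k -> allowed K t -> allowed K t' -> t <> t' ->
  ~~ separates t k h -> ~~ separates t' k h ->
  exists y, balanced_cut K h k t t' y.
Proof.
pose ordered t1 t2 :=
  match t1, t2 with Equal _, Less _ => false | _, _ => true end.
wlog sym : t t' / ordered t t'.
  move=> wl hK kK hk at_ at' tt' th th'.
  case: (boolP (ordered t t')) => [/wl|b]; first exact.
  have b' : ordered t' t by case: (t) (t') b => [?|?] [?|?].
  have [y] := wl t' t b' hK kK hk at' at_ (nesym tt') th' th.
  by move/balanced_cutC; exists y.
case: t t' sym => [a|e] [b|e'] //= _ hK kK; rewrite eqEposition => hk.
- case/and3P=> aK; rewrite ltEposition position_bot => a0 _.
  case/and3P=> bK; rewrite ltEposition position_bot => b0 _ _.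
  rewrite /separates /= !ltEposition => ha hb.
  by case: (ltnP (position h) (position a)) => ?;
  case: (ltnP (position h) (position b)) => ?;
  case: (ltnP (position h) (position k)) => ?;
  case: (ltnP (position a) (position b)) => ?;
  first [cut_at h | cut_at k | cut_at a | cut_at b].
- case/and3P=> aK; rewrite ltEposition position_bot => a0 _ eK _.
  rewrite /separates /= !(ltEposition, eqEposition) => ha he.
  have {he} [ke he] : position k != position e' /\ position h != position e'.
    by split; lia.
  by case: (ltnP (position h) (position a)) => ?;
  case: (ltnP (position h) (position k)) => ?;
  case: (ltnP (position h) (position e')) => ?;
  case: (ltnP (position k) (position e')) => ?;
  case: (ltnP (position a) (position e')) => ?;
  first [exfalso; lia | cut_at h | cut_at k | cut_at a | cut_at e'].
- move=> eK e'K ee'; have {ee'} : e != e' by apply/eqP=> E; rewrite E in ee'.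
  rewrite /separates /= !eqEposition => ee' he he'.
  have {he} [ke he] : position k != position e /\ position h != position e.
    by split; lia.
  have {he'} [ke' he'] : position k != position e' /\ position h != position e'.
    by split; lia.
  by case: (ltnP (position h) (position k)) => ?;
  case: (ltnP (position h) (position e)) => ?;
  case: (ltnP (position h) (position e')) => ?;
  case: (ltnP (position k) (position e)) => ?;
  case: (ltnP (position k) (position e')) => ?;
  case: (ltnP (position e) (position e')) => ?;
  first [exfalso; lia | cut_at h | cut_at k | cut_at e | cut_at e'].
Qed.

(** * Optimal trees for positive weights *)

Section Optimal.
Context {R : realFieldType} (C : {set {set Q}}) (K : {set Q}) (w : Q -> R).
Hypothesis w_gt0 : forall q, 0 < w q.

Definition restricted_cost U T : R := \sum_(q in U) w q * (depth T q)%:R.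

Definition optimal U T : Prop :=
  serves C K U T /\
  forall T', serves C K U T' -> restricted_cost U T <= restricted_cost U T'.

Lemma optimal_legal U T : optimal U T -> legal C K T.
Proof. by case=> /andP[]. Qed.

Lemma optimal_label U T q : optimal U T -> q \in U -> q \in label T q.
Proof. by case=> /serves_label + _; apply. Qed.

(** [f] counts the levels by which a query rises in [T'], [g] those by which it sinks. Optimality
    forbids the weighted rise to exceed the weighted sinking. *)
Lemma exchange U T T' (f g : Q -> nat) :
  optimal U T -> legal C K T' -> (forall q, q \in U -> q \in label T' q) ->
  (forall q, q \in U -> (depth T' q + f q <= depth T q + g q)%N) ->
  \sum_(q in U) w q * (f q)%:R <= \sum_(q in U) w q * (g q)%:R.
Proof.
move=> [_ minT] legalT' labT' le_depth.
have := minT T' (servesP legalT' labT').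
suff: restricted_cost U T' + \sum_(q in U) w q * (f q)%:R <=
      restricted_cost U T + \sum_(q in U) w q * (g q)%:R by lra.
rewrite -!big_split; apply: ler_sum => q qU /=.
by rewrite -!mulrDr -!natrD ler_wpM2l ?ler_nat ?le_depth // ltW.
Qed.

Lemma sum_at U k n :
  k \in U -> \sum_(q in U) w q * (n * (q == k))%:R = n%:R * w k.
Proof.
move=> kU; rewrite (bigD1 k) //= eqxx muln1 mulrC big1 ?addr0 // => q.
by case/andP=> _ /negPf->; rewrite muln0 mulr0.
Qed.

Lemma restricted_cost_node U t T1 T2 :
  restricted_cost U (Node t T1 T2) =
  \sum_(q in U) w q + restricted_cost [set q in U | satisfies t q] T1
  + restricted_cost [set q in U | ~~ satisfies t q] T2.
Proof.
rewrite /restricted_cost -addrA.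
have ->: \sum_(q in U) w q * (depth (Node t T1 T2) q)%:R = \sum_(q in U) w q +
    \sum_(q in U) w q * (depth (if satisfies t q then T1 else T2) q)%:R.
  by rewrite -big_split; apply: eq_bigr => q _ /=; rewrite mulrSr mulrDr mulr1 addrC.
congr (_ + _); rewrite (bigID (satisfies t)) /=; congr (_ + _).
  by apply: eq_big => q; [rewrite inE | case/andP=> _ ->].
by apply: eq_big => q; [rewrite inE | case/andP=> _ /negPf->].
Qed.

Lemma optimal_children U t T1 T2 :
  optimal U (Node t T1 T2) ->
  optimal [set q in U | satisfies t q] T1 /\
  optimal [set q in U | ~~ satisfies t q] T2.
Proof.
rewrite /optimal -!well_formedE /= => -[/and3P[a s1 s2] minT]; split; split=> //.
  move=> T; rewrite -well_formedE => sT; have := minT (Node t T T2).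
  rewrite -well_formedE /= a sT s2 !restricted_cost_node => /(_ isT); lra.
move=> T; rewrite -well_formedE => sT; have := minT (Node t T1 T).
rewrite -well_formedE /= a s1 sT !restricted_cost_node => /(_ isT); lra.
Qed.

Lemma weight_gt0 U : U != set0 -> 0 < \sum_(q in U) w q.
Proof.
case/set0Pn=> k kU; rewrite (bigD1 k) //=.
by rewrite ltr_pwDl // sumr_ge0 // => q _; apply: ltW.
Qed.

Lemma optimal_not_shortened U T T' :
  optimal U T -> U != set0 -> legal C K T' ->
  (forall q, q \in U -> q \in label T' q) ->
  ~ (forall q, q \in U -> (depth T' q < depth T q)%N).
Proof.
move=> oT U0 lT' labT' shorter.
have := exchange (f := fun=> 1%N) (g := fun=> 0%N) oT lT' labT'.
rewrite (eq_bigr w) => [|q _]; last by rewrite mulr1.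
rewrite [X in _ <= X]big1 => [|q _]; last by rewrite mulr0.
rewrite leNgt weight_gt0 // => H; suff: false by []; apply: H => q qU.
by rewrite addn1 addn0 shorter.
Qed.

(** A test with an empty side could be dropped, which shortens every search. *)
Lemma optimal_query_sets U T V :
  optimal U T -> U != set0 -> V \in query_sets U T -> V != set0.
Proof.
elim: T U => [c|t T1 IH1 T2 IH2] U oT U0 /=; first by rewrite inE => /eqP->.
have [o1 o2] := optimal_children oT.
have leg := optimal_legal oT; move: leg => /= /and3P[_ l1 l2].
have n1 : [set q in U | satisfies t q] != set0.
  apply/eqP=> e0; have st q : q \in U -> satisfies t q = false.
    by move=> qU; have := in_set0 q; rewrite -e0 inE qU.
  by apply: (optimal_not_shortened oT U0 l2) => q qU /=;
    have /= := optimal_label oT qU; rewrite st.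
have n2 : [set q in U | ~~ satisfies t q] != set0.
  apply/eqP=> e0; have st q : q \in U -> satisfies t q.
    by move=> qU; have := in_set0 q; rewrite -e0 inE qU => /negbFE.
  by apply: (optimal_not_shortened oT U0 l1) => q qU /=;
    have /= := optimal_label oT qU; rewrite st.
rewrite inE mem_cat => /or3P[/eqP-> //||]; [exact: IH1|exact: IH2].
Qed.

(** * Optimal trees whose root tests equality to a query reaching it *)

Section EqualityRoot.
Variables (U : {set Q}) (h : Q) (L T1 : tree Q).
Hypothesis optT : optimal U (Node (Equal h) L T1).
Hypothesis hU : h \in U.
Local Notation T := (Node (Equal h) L T1).

Let h_in_class : h \in label L h.
Proof. by have := optimal_label optT hU; rewrite /= eqxx. Qed.

(** Otherwise [pull_separator] on [T1], with the class of [h] in [L], lifts [k] by [n] levels and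
    lowers [h] by at most [n], so [n * w k <= n * w h]. *)
Lemma heavier_not_separated k : k \in U -> w h < w k -> ~~ separated T1 h k.
Proof.
move=> kU hk; apply/negP => sep.
have /= /and3P[hK lL l1] := optimal_legal optT.
have [x [S [P [n /= [[_ n0 leg] [labh lab dep depk deph]]]]]] :=
  pull_separator l1 sep hK (label_class h lL).
have := exchange (f := fun q => (n * (q == k))%N)
  (g := fun q => (n * (q == h))%N) optT leg.
rewrite !sum_at // ler_pM2l ?ltr0n // leNgt hk => H; suff: false by [].
apply: H => q qU.
  have [->|qh] := eqVneq q h; first by rewrite labh.
  by have := optimal_label optT qU; rewrite lab //= (negPf qh).
have [->|qh] := eqVneq q h.
  have [hk'|_] := eqVneq h k; first by rewrite hk' ltxx in hk.
  by rewrite /= eqxx muln1 muln0 addn0; lia.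
have := dep q qh; rewrite /= (negPf qh) muln0 addn0.
by have [->|_] := eqVneq q k; rewrite ?muln1 // muln0 addn0.
Qed.

Lemma heavier_same_label p q :
  p \in U -> q \in U -> w h < w p -> w h < w q -> label T p = label T q.
Proof.
move=> pU qU hp hq; rewrite /=.
have [e|_] := eqVneq p h; first by rewrite e ltxx in hp.
have [e|_] := eqVneq q h; first by rewrite e ltxx in hq.
have [<- _] := separatedPn (heavier_not_separated pU hp).
by have [<- _] := separatedPn (heavier_not_separated qU hq).
Qed.

(** If the leaf of [k] could also take [h], the root could test [= k] instead: [k] rises by its
    depth in [T1], and [h], following the old path of [k], sinks by no more. *)
Lemma heavier_key_class k :
  k \in U -> k \in K -> w h < w k -> h \notin label T k.
Proof.
move=> kU kK hk; apply/negP.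
have kh : k != h by apply: contraTneq hk => ->; rewrite ltxx.
have [labE depE] := separatedPn (heavier_not_separated kU hk).
have /= /and3P[hK lL l1] := optimal_legal optT.
have := optimal_label optT kU; rewrite /= (negPf kh) -labE => k_in h_in.
case: (posnP (depth T1 k)) => [d0|d0].
  have U0 : U != set0 by apply/set0Pn; exists h.
  case: (optimal_not_shortened optT U0 l1) => q qU; have [->//|qh] := eqVneq q h.
  - by have := optimal_label optT qU; rewrite /= (negPf qh).
  - by rewrite depE d0.
  - by rewrite /= (negPf qh).
have := exchange (T' := Node (Equal k) (Leaf (label T1 h)) T1)
  (f := fun q => (depth T1 k * (q == k))%N)
  (g := fun q => (depth T1 k * (q == h))%N) optT.
rewrite !sum_at // ler_pM2l ?ltr0n // leNgt hk /= kK l1 (label_class h l1).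
move=> H; suff: false by []; apply: H => // q qU /=.
  have [->//|qk] := eqVneq q k; have [->//|qh] := eqVneq q h.
  by have := optimal_label optT qU; rewrite /= (negPf qh).
have [->|qk] := eqVneq q k.
  by rewrite (negPf kh) muln0 muln1 addn0; case: (L).
have [->|qh] := eqVneq q h; rewrite muln0 addn0 ?muln0 ?addn0 //.
by rewrite muln1 depE addSn ltnS leq_addl.
Qed.

(** A test [= k] placed above the root brings [k] to depth one and costs every query at most one
    level. *)
Lemma weight_ge_depth k :
  k \in U -> k \in K -> (depth T k)%:R * w k <= \sum_(q in U) w q.
Proof.
move=> kU kK; rewrite -(sum_at (U := U)) //.
have -> : \sum_(q in U) w q = \sum_(q in U) w q * 1%:R.
  by apply: eq_bigr => q _; rewrite mulr1.
apply: (exchange (T' := Node (Equal k) (Leaf (label T k)) T) optT).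
- have lT := optimal_legal optT; have lk := label_class k lT.
  by move: lT lk => /= -> ->; rewrite kK.
- move=> q qU; suff: q \in if q == k then label T k else label T q.
    by rewrite /=; case: (q == k).
  case: (eqVneq q k) => [->|_].
    exact: optimal_label optT kU.
  exact: optimal_label optT qU.
- move=> q qU /=; have [->|_] := eqVneq q k; first by rewrite muln1 addnC.
  by rewrite muln0 addn0 addn1.
Qed.

(** * Excluding four tests above a heavier key *)

Section LongPath.
Variables (k : Q) (t2 t3 t4 : test Q) (E2 E3 E4 Z : tree Q).
Hypothesis T1E : T1 = branch t2 k E2 (branch t3 k E3 (branch t4 k E4 Z)).
Hypotheses (kU : k \in U) (kK : k \in K) (hk : w h < w k).

Let legals : [/\ h \in K, [&& allowed K t2, allowed K t3 & allowed K t4],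
  legal C K L & [&& legal C K E2, legal C K E3, legal C K E4 & legal C K Z]].
Proof.
have := optimal_legal optT; rewrite /= T1E !legal_branch.
by case/and3P=> -> -> /and3P[-> -> /and3P[-> -> /and3P[-> -> ->]]].
Qed.

Let h_neq_k : h != k.
Proof. by apply: contraTneq hk => ->; rewrite ltxx. Qed.

Let not_separating :
  [/\ ~~ separates t2 k h, ~~ separates t3 k h & ~~ separates t4 k h].
Proof.
have := heavier_not_separated kU hk.
by rewrite T1E !separated_branch !negb_or => /and4P[-> -> ->].
Qed.

(** Boolean implications at a single query, which reduce to constants once the outcomes of all tests
    are fixed. *)
Let at_h_k q :
  ((q == h) ==> [&& ~~ separates t2 k q, ~~ separates t3 k q,
                    ~~ separates t4 k q & q != k]) /\
  ((q == k) ==> [&& ~~ separates t2 k q, ~~ separates t3 k q &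
                    ~~ separates t4 k q]).
Proof.
have [s2 s3 s4] := not_separating; split; apply/implyP=> /eqP->.
  by rewrite s2 s3 s4 h_neq_k.
by rewrite !separates_id.
Qed.

Let exchange_path T' (f g : Q -> nat) :
  legal C K T' -> (forall q, label T' q = label T q) ->
  (forall q, q \in U -> (depth T' q + f q <= depth T q + g q)%N) ->
  \sum_(q in U) w q * (f q)%:R <= \sum_(q in U) w q * (g q)%:R.
Proof.
move=> lT' labE; apply: (exchange optT lT') => q qU.
by rewrite labE; apply: optimal_label optT qU.
Qed.

(* Taking [T'] instead would trade [w k] for the smaller [w h]. *)
Let no_gain T' :
  legal C K T' -> (forall q, label T' q = label T q) ->
  (forall q, (depth T' q + (q == k) <= depth T q + (q == h))%N) -> False.
Proof.
move=> lT' labE depE; have := exchange_path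
  (f := fun q => (1 * (q == k))%N) (g := fun q => (1 * (q == h))%N) lT' labE.
rewrite !sum_at // !mul1r leNgt hk => H; suff: false by []; apply: H => q _.
by rewrite !mul1n.
Qed.

Let second_exit : R := \sum_(q in U) w q * (separates t2 k q)%:R.

(** Swapping [= h] and [t2] lifts the exit of [t2] by one level and lowers only [h], by one. *)
Let second_exit_le : second_exit <= w h.
Proof.
have [hK /and3P[a2 a3 a4] lL /and4P[l2 l3 l4 lZ]] := legals.
rewrite -[w h]mul1r -[1]/(1%:R) -(sum_at (U := U)) //.
apply: (exchange_path (T' := branch t2 k E2
  (Node (Equal h) L (branch t3 k E3 (branch t4 k E4 Z))))).
- by rewrite !legal_branch /= !legal_branch a2 a3 a4 hK lL l2 l3 l4 lZ.
- move=> q; rewrite !(T1E, label_node, label_branch) /=; have [] := at_h_k q.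
  by case: (q == h); case: (separates t2 k q).
- move=> q _; rewrite !(T1E, depth_node, depth_branch) /=; have [] := at_h_k q.
  by case: (q == h); case: (separates t2 k q) => //= _ _;
    rewrite ?addn0 ?addn1.
Qed.

(** A repetition of [t2] right below itself on the path of [k] decides nothing; dropping it lifts
    [k] for free. *)
Let third_differs : t2 <> t3.
Proof.
move=> t23; have [hK /and3P[a2 a3 a4] lL /and4P[l2 l3 l4 lZ]] := legals.
have lT' : legal C K (Node (Equal h) L (branch t2 k E2 (branch t4 k E4 Z))).
  by rewrite /= !legal_branch a2 a4 hK lL l2 l4 lZ.
have := exchange_path (f := fun q => (1 * (q == k))%N) (g := fun=> 0%N) lT'.
rewrite sum_at // mul1r [X in _ <= X]big1 => [|q _]; last by rewrite mulr0.
rewrite leNgt w_gt0 => H; suff: false by []; apply: H => q.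
  by rewrite !(T1E, label_node, label_branch) -t23 /=; case: (separates t2 k q).
move=> _; rewrite !(T1E, depth_node, depth_branch) -t23 addn0 mul1n /=.
have [] := at_h_k q; case: (q == h); case: (q == k);
  by case: (separates t2 k q); rewrite ?andbF //= => _ _; clear; lia.
Qed.

Ltac by_outcomes x q :=
  have [] := at_h_k q;
  case: (q == h); case: (q == k); case: (separates t2 k q);
  case: (separates t3 k q); case: (separates t4 k q); case: (separates x k q);
  rewrite ?andbF //= => *; clear; lia.

Let no_balanced_cut y : ~ balanced_cut K h k t2 t3 y.
Proof.
have [hK /and3P[a2 a3 a4] lL /and4P[l2 l3 l4 lZ]] := legals.
have [nt2 nt3 nt4] := not_separating.
case; move: (Less y) => x ax.
have xk q : (q == k) ==> ~~ separates x k q.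
  by apply/implyP=> /eqP->; rewrite separates_id.
have xh b : separates x k h = b -> forall q, (q == h) ==> (separates x k q == b).
  by move=> <- q; apply/implyP=> /eqP->.
have neg t : (forall q, separates t k q -> ~~ separates x k q) ->
    forall q, separates t k q ==> separates x k q (+) true.
  by move=> s q; rewrite addbT; apply/implyP/s.
have pos t : (forall q, separates t k q -> separates x k q) ->
    forall q, separates t k q ==> separates x k q (+) false.
  by move=> s q; rewrite addbF; apply/implyP/s.
have legalE := (ax, a2, a3, a4, hK, lL, l2, l3, l4, lZ).
case=> [[/negbTE/xh{}xh /pos s2 /pos s3]|[/[dup] sxh /xh{}xh /pos s2 /neg s3]|
        [/xh{}xh /neg s2 /pos s3]].
(* Both exits are cut off: [k] skips [t2] and [t3], and the far side skips [= h]. *)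
- apply: (@no_gain (branch x k
    (branch t2 k E2 (branch t3 k E3 (branch t4 k E4 Z)))
    (Node (Equal h) L (branch t4 k E4 Z)))) => [|q|q].
  + by rewrite !legal_branch /= !legal_branch !legalE.
  + rewrite !(T1E, label_node, label_branch) /=.
    move: (s2 q) (s3 q) (xh q) (xk q); by_outcomes x q.
  + rewrite !(T1E, depth_node, depth_branch) /=.
    move: (s2 q) (s3 q) (xh q) (xk q); by_outcomes x q.
- have W4 : 4%:R * w k <= \sum_(q in U) w q.
    have d4 : (4 <= depth T k)%N.
      rewrite T1E depth_node !depth_branch !separates_id /= eq_sym.
      by rewrite (negPf h_neq_k).
    by apply: le_trans (weight_ge_depth kU kK); rewrite ler_pM2r ?ler_nat.
  have sumE : \sum_(q in U) w q * (1 * (q == h) + separates t2 k q)%:R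
      = w h + second_exit.
    rewrite (eq_bigr _ (fun q _ => congr1 (fun z => w q * z) (natrD _ _ _))).
    rewrite (eq_bigr _ (fun q _ => mulrDr _ _ _)) big_split /=.
    by congr (_ + _); have := sum_at 1 hU; rewrite mul1r.
  have b2 := second_exit_le.
  have contra1 (u z b : R) : u < z -> b <= u -> 2%:R * z <= u + b -> False.
    by move=> ? ? ?; lra.
  have contra2 (u z b W : R) : u < z -> b <= u -> 4%:R * z <= W ->
      W <= 2%:R * (u + b) -> False.
    by move=> ? ? ? ?; lra.
  case: (separates_side nt4 sxh) => [/pos s4|/neg s4].
    (* The exit of [t4] is on the far side: [k] rises by two levels, while [h] and the exit of [t2]
       sink by one. *)
    have lT' : legal C K (branch x k
        (Node (Equal h) L (branch t2 k E2 (branch t4 k E4 Z)))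
        (branch t3 k E3 Z)).
      by rewrite !legal_branch /= !legal_branch !legalE.
    have := exchange_path (f := fun q => (2 * (q == k))%N)
      (g := fun q => (1 * (q == h) + separates t2 k q)%N) lT'.
    rewrite sum_at // sumE => H; apply: (contra1 _ _ _ hk b2); apply: H => [q|q _].
    + rewrite !(T1E, label_node, label_branch) /=.
      move: (s2 q) (s3 q) (s4 q) (xh q) (xk q); by_outcomes x q.
    + rewrite !(T1E, depth_node, depth_branch) /=.
      move: (s2 q) (s3 q) (s4 q) (xh q) (xk q); by_outcomes x q.
  have lT' : legal C K (branch x k
      (Node (Equal h) L (branch t2 k E2 Z))
      (branch t3 k E3 (branch t4 k E4 Z))).
    by rewrite !legal_branch /= !legal_branch !legalE.
  (* Every query rises at least one level, except that [h] and the exit of [t2] sink by one; this is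
     written as a rise of one for all and a sinking of two for these. *)
  have := exchange_path (f := fun=> 1%N)
    (g := fun q => (2 * (1 * (q == h) + separates t2 k q))%N) lT'.
  have -> : \sum_(q in U) w q * (2 * (1 * (q == h) + separates t2 k q))%:R
      = 2%:R * (w h + second_exit).
    by rewrite -sumE mulr_sumr; apply: eq_bigr => q _; rewrite natrM mulrCA.
  rewrite (eq_bigr w) => [H|q _]; last by rewrite mulr1.
  apply: (contra2 _ _ _ _ hk b2 W4); apply: H => [q|q _].
  + rewrite !(T1E, label_node, label_branch) /=.
    move: (s2 q) (s3 q) (s4 q) (xh q) (xk q); by_outcomes x q.
  + rewrite !(T1E, depth_node, depth_branch) /=.
    move: (s2 q) (s3 q) (s4 q) (xh q) (xk q); by_outcomes x q.
(* [h] and the exit of [t3] are cut off: [k] skips [= h] and [t3], and the far side skips [t2]. *)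
- apply: (@no_gain (branch x k
    (Node (Equal h) L (branch t3 k E3 (branch t4 k E4 Z)))
    (branch t2 k E2 (branch t4 k E4 Z)))) => [|q|q].
  + by rewrite !legal_branch /= !legal_branch !legalE.
  + rewrite !(T1E, label_node, label_branch) /=.
    move: (s2 q) (s3 q) (xh q) (xk q); by_outcomes x q.
  + rewrite !(T1E, depth_node, depth_branch) /=.
    move: (s2 q) (s3 q) (xh q) (xk q); by_outcomes x q.
Qed.

Lemma no_long_path : False.
Proof.
have [hK /and3P[a2 a3 _] _ _] := legals; have [s2 s3 _] := not_separating.
have [y] := balanced_cut_exists hK kK h_neq_k a2 a3 third_differs s2 s3.
exact: no_balanced_cut.
Qed.

End LongPath.

Lemma heavier_key_depth k :
  k \in U -> k \in K -> w h < w k -> (depth T k <= 3)%N.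
Proof.
move=> kU kK hk; rewrite leqNgt; apply/negP => d4.
have kh : k != h by apply: contraTneq hk => ->; rewrite ltxx.
have path X : (0 < depth X k)%N -> exists t E X', X = branch t k E X'.
  case: X => // t X1 X2 _; exists t, (if satisfies t k then X2 else X1),
    (if satisfies t k then X1 else X2); exact: branchE.
move: d4; rewrite /= (negPf kh) => d4.
have [t2 [E2 [X2 T1E]]] := path T1 (@leq_trans 3 1 _ isT d4).
move: d4; rewrite T1E depth_branch separates_id => d4.
have [t3 [E3 [X3 X2E]]] := path X2 (@leq_trans 2 1 _ isT d4).
move: d4; rewrite X2E depth_branch separates_id => d4.
have [t4 [E4 [Z X3E]]] := path X3 (@leq_trans 1 1 _ isT d4).
rewrite X2E X3E in T1E.
exact: no_long_path T1E kU kK hk.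
Qed.

End EqualityRoot.
End Optimal.
End Structure.

(** * Holes and admissibility *)

Section Holes.
Context {d : Order.disp_t} {Q : finTBOrderType d}.
Implicit Types (U V H : {set Q}) (h k q : Q) (t : test Q) (T : tree Q).

(** Since [V] is nonempty, the defaults [\top] and [\bot] are neutral and both bounds are attained
    in [V]. *)
Lemma hull_bounds V k q : k \in V -> q \in hull V ->
  (exists2 p, p \in V & (p <= q)%O) /\ (exists2 p, p \in V & (q <= p)%O).
Proof.
move=> kV; rewrite inE => /andP[minq maxq]; split.
  have [|p pV pE] := @eq_bigmin _ _ _ \top%O k (mem V) id kV.
    by move=> i _; apply: lex1.
  by exists p; rewrite // -pE.
have [|p pV pE] := @eq_bigmax _ _ _ \bot%O k (mem V) id kV.
  by move=> i _; apply: le0x.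
by exists p; rewrite // -pE.
Qed.

(** The outcome of a comparison that is constant on [V] is constant on its hull. An equality test
    answering yes on all of [V] makes [V] a single point, which has no holes. *)
Lemma hole_outcome V k t b h :
  k \in V -> (forall q, q \in V -> satisfies t q = b) -> h \in holes V ->
  satisfies t h = b \/ t = Equal h.
Proof.
move=> kV tV; rewrite inE => /andP[hV].
case/(hull_bounds kV) => -[p pV ph] [p' p'V hp'].
case: t tV => [m|e] /= tV.
  left; case: b tV => tV; first exact: le_lt_trans hp' (tV _ p'V).
  by apply/negbTE; rewrite -leNgt (le_trans _ ph) // leNgt tV.
have [->|he] := eqVneq e h; [by right | left].
case: b tV => tV; rewrite ?(negPf he) // 1?eq_sym ?(negPf he) //.
move: hV; have /eqP pe := tV p pV; have /eqP p'e := tV p' p'V.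
by rewrite pe in ph; rewrite p'e in hp'; move: he; rewrite eq_le ph hp'.
Qed.

Lemma query_sets_sub U T V : V \in query_sets U T -> V \subset U.
Proof.
elim: T U => [c|t T1 IH1 T2 IH2] U /=; first by rewrite inE => /eqP->.
rewrite inE mem_cat => /or3P[/eqP->|/IH1|/IH2] // /subset_trans; apply;
by apply/subsetP=> q; rewrite inE => /andP[].
Qed.

Lemma query_sets_node U t T1 T2 V :
  V \in query_sets U (Node t T1 T2) -> V = U \/
  exists b, V \in query_sets [set q in U | satisfies t q == b] (if b then T1 else T2).
Proof.
rewrite /= inE mem_cat => /or3P[/eqP->|V1|V2]; [by left | right..].
  exists true; rewrite (_ : [set _ in _ | _] = [set q in U | satisfies t q]) //.
  by apply/setP=> q; rewrite !inE eqb_id.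
exists false; rewrite (_ : [set _ in _ | _] = [set q in U | ~~ satisfies t q]) //.
by apply/setP=> q; rewrite !inE eqbF_neg.
Qed.

Lemma holes_disjoint V H : H \subset V -> H \subset holes V -> H = set0.
Proof.
move=> /subsetP HV /subsetP Hh; apply/setP=> q; rewrite inE.
by apply/negP=> qH; have := Hh q qH; rewrite inE HV.
Qed.

(** Every hole must be removed by its own equality test, and these tests all lie on the path of
    [k]. *)
Lemma card_holes_le_depth U T V k H :
  V \in query_sets U T -> k \in V -> H \subset U -> H \subset holes V ->
  (#|H| <= depth T k)%N.
Proof.
elim: T U H => [c|t T1 IH1 T2 IH2] U H.
  rewrite inE => /eqP-> _ HU Hh; by rewrite (holes_disjoint HU Hh) cards0.
move=> /query_sets_node[->|[b Vb]] kV HU Hh.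
  by rewrite (holes_disjoint HU Hh) cards0.
have sub := subsetP (query_sets_sub Vb).
have tV q : q \in V -> satisfies t q = b.
  by move/sub; rewrite inE => /andP[_ /eqP].
pose H' := H :&: [set q in U | satisfies t q == b].
have H'sub : H' \subset [set q in U | satisfies t q == b] by apply: subsetIr.
have H'h : H' \subset holes V by apply: subset_trans (subsetIl _ _) Hh.
have le1 : (#|H :\: H'| <= 1)%N.
  apply/card_le1_eqP => x y xH yH.
  have tE z : z \in H :\: H' -> t = Equal z.
    rewrite !inE => /andP[/[swap] zH]; rewrite zH (subsetP HU) //= => tz.
    case: (hole_outcome kV tV (subsetP Hh z zH)) => // tz'.
    by rewrite tz' eqxx in tz.
  by move: (tE x xH); rewrite (tE y yH) => -[].
have H'depth : (#|H'| <= depth (if b then T1 else T2) k)%N.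
  by case: b Vb @H' H'sub H'h {sub tV le1} => Vb H' H'sub H'h;
    [apply: IH1 Vb _ _ _ | apply: IH2 Vb _ _ _].
rewrite depth_node tV // -(cardsID H' H) (setIidPr (subsetIl _ _)).
rewrite addnC -add1n; apply: leq_add le1 _.
by rewrite -(fun_if (fun X => depth X k)).
Qed.

Section Admissibility.
Context {R : realFieldType} (C : {set {set Q}}) (K : {set Q}) (w : Q -> R).
Hypothesis w_gt0 : forall q, 0 < w q.

(* The topmost test on the way to [V] that removes a member of [H]. *)
Lemma first_hole_test U T V k H :
  optimal C K w U T -> V \in query_sets U T -> k \in V ->
  H != set0 -> H \subset U -> H \subset holes V ->
  exists U' h L T1, let T' := Node (Equal h) L T1 in
    [/\ optimal C K w U' T', h \in H & H \subset U'] /\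
    [/\ V \in query_sets U' T', V \subset U' &
        forall q, q \in V -> label T' q = label T q].
Proof.
move=> + + kV H0; elim: T U => [c|t T1 IH1 T2 IH2] U oT.
  rewrite inE => /eqP-> HU Hh; by rewrite (holes_disjoint HU Hh) eqxx in H0.
move=> VT; case: (query_sets_node VT) => [->|[b Vb]] HU Hh.
  by rewrite (holes_disjoint HU Hh) eqxx in H0.
have VU := query_sets_sub VT; have sub := subsetP (query_sets_sub Vb).
have tV q : q \in V -> satisfies t q = b.
  by move/sub; rewrite inE => /andP[_ /eqP].
(* Either the root test removes a member of [H], or all of [H] follows [V] into the same child. *)
case: (boolP [exists h in H, satisfies t h != b]) => [/exists_inP[h hH th]|].
  have [th'|tE] := hole_outcome kV tV (subsetP Hh h hH).
    by rewrite th' eqxx in th.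
  by exists U, h, T1, T2; rewrite -tE.
rewrite negb_exists_in => /forall_inP same.
have HUb : H \subset [set q in U | satisfies t q == b].
  apply/subsetP=> q qH; rewrite inE (subsetP HU) //=.
  by have := same q qH; rewrite negbK.
have oTb : optimal C K w [set q in U | satisfies t q == b] (if b then T1 else T2).
  have [o1 o2] := optimal_children oT; case: (b).
    by rewrite (_ : [set _ in _ | _] = [set q in U | satisfies t q]) //;
      apply/setP=> q; rewrite !inE eqb_id.
  by rewrite (_ : [set _ in _ | _] = [set q in U | ~~ satisfies t q]) //;
    apply/setP=> q; rewrite !inE eqbF_neg.
have labb q : q \in V -> label (if b then T1 else T2) q = label (Node t T1 T2) q.
  by move=> qV; rewrite /= tV //; case: (b).
have [U' [h [L [T' [P1 [V' VU' lab]]]]]] :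
    exists U' h L T', let T'' := Node (Equal h) L T' in
    [/\ optimal C K w U' T'', h \in H & H \subset U'] /\
    [/\ V \in query_sets U' T'', V \subset U' &
        forall q, q \in V -> label T'' q = label (if b then T1 else T2) q].
  by case: (b) Vb oTb HUb => Vb oTb HUb;
    [apply: IH1 oTb Vb HUb Hh | apply: IH2 oTb Vb HUb Hh].
exists U', h, L, T'; split=> //; split=> // q qV.
by rewrite lab // labb.
Qed.

Variable s : seq Q.
Hypothesis w_rank : forall p q, (wrank s p < wrank s q)%N -> w p < w q.
Hypothesis wrank_inj : injective (wrank s).

(** Above an element of [H] there are only other elements of [H], fewer than [#|H|]; above an
    element of [X] outside [H] lies all of [H]. *)
Lemma heaviest_upper (X H : {set Q}) :
  H \subset X ->
  (forall h x, h \in H -> x \in X -> (wrank s h < wrank s x)%N -> x \in H) ->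
  heaviest s #|H| X = H.
Proof.
move=> /subsetP HX up; apply/setP=> q; rewrite inE; apply/andP/idP => [[qX]|qH].
  apply: contraLR => qH; rewrite -leqNgt; apply/subset_leq_card/subsetP => h hH.
  rewrite inE HX //= ltn_neqAle; apply/andP; split.
    by apply: contraNneq qH => /wrank_inj->.
  by rewrite leqNgt; apply: contra qH; apply: up qX.
split; first exact: HX.
apply/proper_card/properP; split.
  by apply/subsetP=> p; rewrite inE => /andP[pX]; apply: up qH pX.
by exists q; rewrite // inE ltnn andbF.
Qed.

Lemma optimal_admissible T : optimal C K w [set: Q] T -> admissible_tree s C K T.
Proof.
move=> oT V VT; split.
  apply: (optimal_query_sets w_gt0 oT _ VT).
  by apply/set0Pn; exists \bot%O; rewrite inE.
have [->|H0] := eqVneq (light_holes s K V) set0; [by left | right].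
set H := light_holes s K V in H0 *.
case kE: (kstar s K V) => [k|]; last first.
  by rewrite /H /light_holes kE /= setI0 eqxx in H0.
have [kV kK] : k \in V /\ k \in K.
  move: kE; rewrite /kstar; case: pickP => // k' /andP[k'VK _] [<-].
  by apply/andP; rewrite -in_setI.
have Hholes : H \subset holes V by apply: subsetIl.
have lighterk h : h \in H -> (wrank s h < wrank s k)%N.
  by rewrite inE kE /= => /andP[_]; rewrite inE.
(* Each light hole is treated separately, at the node whose equality test removes it. *)
have heavier_than h : h \in H ->
    [/\ h \in K, h \notin label T k &
      forall q, q \in V -> (wrank s h < wrank s q)%N -> q \in label T k].
  move=> hH; have hk := w_rank (lighterk h hH).
  have H1 : [set h] \subset holes V by rewrite sub1set (subsetP Hholes).
  have h0 : [set h] != set0 by apply/set0Pn; exists h; rewrite inE.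
  have [U' [h' [L [T1 [[oT' + hU'] [VU' /subsetP VsubU' lab]]]]]] :=
    first_hole_test oT VT kV h0 (subsetT _) H1.
  rewrite inE => /eqP h'E; rewrite {}h'E sub1set in oT' hU' VU' lab.
  have kU' := VsubU' k kV; split.
  - by have /= /and3P[] := optimal_legal oT'.
  - by rewrite -lab // (heavier_key_class w_gt0 oT').
  - move=> q qV hq; have qU' := VsubU' q qV.
    rewrite -lab // -(heavier_same_label w_gt0 oT' hU' qU' kU' (w_rank hq) hk).
    exact: optimal_label oT' qU'.
exists #|H|, (label T k), k; split=> //.
- rewrite card_gt0 H0 /=.
  (* At the topmost node removing a light hole, all light holes are still present, so their number
     is at most the depth of [k] below it. *)
  have [U' [h [L [T1 [[oT' hH HU'] [VU' /subsetP VsubU' lab]]]]]] :=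
    first_hole_test oT VT kV H0 (subsetT _) Hholes.
  apply: leq_trans (card_holes_le_depth VU' kV HU' Hholes) _.
  by apply: (heavier_key_depth w_gt0 oT' (subsetP HU' h hH) (VsubU' k kV) kK);
    apply/w_rank/lighterk.
- exact: label_class (optimal_legal oT).
- by apply: optimal_label oT _; rewrite inE.
symmetry; apply: heaviest_upper.
  apply/subsetP=> h hH; have [hK hc _] := heavier_than h hH.
  have /setIP[/setDP[h_hull _] h_lighter] := hH.
  by rewrite in_setD !in_setI hc hK h_hull -kE.
(* If [x] were in [V], being heavier than [h] it would share the class of [k]; so it is a hole. *)
move=> h x hH; have [_ _ up] := heavier_than h hH.
case/setDP=> /setIP[/setIP[xK x_hull] x_lighter] xc hx.
rewrite in_setI kE x_lighter andbT in_setD x_hull andbT.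
by apply: contra xc => xV; apply: up.
Qed.

End Admissibility.
End Holes.

(** * Tie-breaking by perturbation *)

Section Perturbation.
Context {R : realFieldType} {d : Order.disp_t} {Q : finTBOrderType d}.
Implicit Types (w : Q -> R) (C : {set {set Q}}) (K U : {set Q}) (T : tree Q).

(** Tests with an empty side are dropped; each remaining test passes on strictly fewer queries. *)
Lemma bounded_depth C K U T :
  serves C K U T -> exists2 T', serves C K U T' &
    forall q, q \in U -> (depth T' q <= minn (depth T q) #|U|)%N.
Proof.
rewrite -well_formedE; elim: T U => [c|t T1 IH1 T2 IH2] U.
  by exists (Leaf c) => //; rewrite -well_formedE.
move=> /= /and3P[at_ /IH1[S1 s1 d1] /IH2[S2 s2 d2]].
set U1 := [set q in U | satisfies t q] in s1 d1.
set U2 := [set q in U | ~~ satisfies t q] in s2 d2.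
have cardU : (#|U1| + #|U2| = #|U|)%N.
  rewrite -(cardsID [set q | satisfies t q] U); congr (_ + _)%N;
  by apply: eq_card => q; rewrite !inE // andbC.
have [U10|U1n] := eqVneq U1 set0.
  have U2E : U2 = U.
    by apply/eqP; rewrite eqEcard -cardU U10 cards0 leqnn andbT;
      apply/subsetP=> q; rewrite inE => /andP[].
  rewrite U2E in s2 d2; exists S2 => // q qU.
  have tq : satisfies t q = false.
    by have := in_set0 q; rewrite -U10 inE qU.
  by rewrite tq; apply: leq_trans (d2 q qU) _; rewrite leq_min geq_minr andbT
    (leq_trans (geq_minl _ _)).
have [U20|U2n] := eqVneq U2 set0.
  have U1E : U1 = U.
    by apply/eqP; rewrite eqEcard -cardU U20 cards0 addn0 leqnn andbT;
      apply/subsetP=> q; rewrite inE => /andP[].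
  rewrite U1E in s1 d1; exists S1 => // q qU.
  have tq : satisfies t q.
    by have := in_set0 q; rewrite -U20 inE qU => /negbFE.
  by rewrite tq; apply: leq_trans (d1 q qU) _; rewrite leq_min geq_minr andbT
    (leq_trans (geq_minl _ _)).
exists (Node t S1 S2); first by rewrite -well_formedE /= at_ !well_formedE s1 s2.
rewrite -!card_gt0 in U1n U2n.
move=> q qU /=; case: (boolP (satisfies t q)) => tq.
  have /d1 : q \in U1 by rewrite inE qU.
  by move: cardU U2n => /=; clear; lia.
have /d2 : q \in U2 by rewrite inE qU tq.
by move: cardU U1n => /=; clear; lia.
Qed.

Lemma cost_optimal w C K T :
  optimal C K w [set: Q] T <-> minimum_cost w C K T.
Proof.
have costE T' : restricted_cost w [set: Q] T' = cost w T'.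
  by apply: eq_bigl => q; rewrite inE.
split=> -[sT minT]; split; rewrite ?/decision_tree ?well_formedE // in sT *.
  by move=> T'; rewrite /decision_tree well_formedE -!costE; apply: minT.
by move=> T' sT'; rewrite !costE; apply: minT; rewrite /decision_tree well_formedE.
Qed.

(** The cost depends only on the depth function, and by [bounded_depth] finitely many depth
    functions suffice, so the minimum is attained. *)
Lemma minimum_cost_bounded w C K :
  (forall q, 0 <= w q) -> (exists T, decision_tree C K T) ->
  exists2 T, minimum_cost w C K T & forall q, (depth T q <= #|Q|)%N.
Proof.
move=> w_ge0 [T0 sT0].
pose cost_of (f : {ffun Q -> 'I_#|Q|.+1}) : R := \sum_q w q * (f q)%:R.
pose realized (f : {ffun Q -> 'I_#|Q|.+1}) :=
  `[< exists2 T, decision_tree C K T & forall q, depth T q = f q >].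
have realize T : decision_tree C K T ->
    exists2 f, realized f & cost_of f <= cost w T.
  rewrite /decision_tree well_formedE => /bounded_depth[T' sT' le_depth].
  have le_dT q : (depth T' q <= minn (depth T q) #|Q|)%N.
    by rewrite -cardsT le_depth ?inE.
  exists [ffun q => inord (depth T' q)].
    apply/asboolP; exists T'; first by rewrite /decision_tree well_formedE.
    move=> q; rewrite ffunE inordK // ltnS (leq_trans (le_dT q)) //.
    exact: geq_minr.
  apply: ler_sum => q _; rewrite ler_wpM2l // ler_nat ffunE inordK.
    exact: leq_trans (le_dT q) (geq_minl _ _).
  by rewrite ltnS (leq_trans (le_dT q)) ?geq_minr.
have [f0 rf0 _] := realize _ sT0.
case: (@arg_minP _ R _ f0 realized cost_of rf0) => f /asboolP[T sT dT] minf.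
exists T; last by move=> q; rewrite dT -ltnS.
split=> // T' /realize[f' /minf le_f]; apply: le_trans.
suff -> : cost w T = cost_of f by [].
by apply: eq_bigr => q _; rewrite dT.
Qed.

(** The default 1 keeps the minimum positive when no [F i] is. *)
Lemma positive_gap (I : finType) (F : I -> R) :
  exists2 delta, 0 < delta & forall i, 0 < F i -> delta <= F i.
Proof.
exists (\big[Order.min/1]_(i | 0 < F i) F i); first exact: lt_bigmin.
by move=> i Fi; apply: bigmin_le_cond.
Qed.

(** Under [w], a minimum for the perturbed weights exceeds the optimum by at most [e * cost r T0],
    which is below the least positive excess of a bounded depth function. *)
Lemma perturbed_minimum w (r : Q -> R) C K :
  (forall q, 0 <= w q) -> (forall q, 0 <= r q) ->
  (exists T, decision_tree C K T) ->
  exists2 e, 0 < e & exists2 T, minimum_cost w C K T &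
    minimum_cost (fun q => w q + e * r q) C K T.
Proof.
move=> w_ge0 r_ge0 feasible.
have [T0 [sT0 minT0] _] := minimum_cost_bounded w_ge0 feasible.
have [delta delta0 gap] := positive_gap
  (fun f : {ffun Q -> 'I_#|Q|.+1} => \sum_q w q * (f q)%:R - cost w T0).
have r0 : 0 <= cost r T0 by apply: sumr_ge0 => q _; rewrite mulr_ge0.
(* Adding 1 keeps the denominator positive and makes [e * cost r T0 < delta] strict. *)
pose e := delta / (cost r T0 + 1).
have e0 : 0 < e by rewrite divr_gt0 // ltr_wpDl.
have costE T : cost (fun q => w q + e * r q) T = cost w T + e * cost r T.
  by rewrite /cost mulr_sumr -big_split; apply: eq_bigr => q _ /=; ring.
exists e => //; have [|T minT boundT] := @minimum_cost_bounded
    (fun q => w q + e * r q) C K _ feasible.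
  by move=> q; rewrite addr_ge0 // mulr_ge0 // ltW.
exists T => //; have [sT leT] := minT; split=> // T' sT'.
apply: le_trans (minT0 T' sT'); rewrite leNgt; apply/negP=> T0T.
have := gap [ffun q => inord (depth T q)].
have -> : \sum_q w q * ([ffun q => inord (depth T q)] q : 'I_#|Q|.+1)%:R = cost w T.
  by apply: eq_bigr => q _; rewrite ffunE inordK // ltnS.
rewrite subr_gt0 => /(_ T0T) leTd.
have := leT _ sT0; rewrite !costE => le_e.
have rT : 0 <= e * cost r T.
  by rewrite mulr_ge0 ?(ltW e0) // sumr_ge0 // => q _; rewrite mulr_ge0.
have : e * (cost r T0 + 1) = delta by rewrite divfK // gt_eqF // ltr_wpDl.
rewrite mulrDr mulr1 => eE.
by move: rT le_e leTd eE e0; clear; lra.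
Qed.

Lemma wrank_inj w s : weight_ordering w s -> injective (wrank s).
Proof.
case/andP=> /perm_mem ms _ p q [/(congr1 (nth p s))].
by rewrite !nth_index ?ms ?mem_enum.
Qed.

Lemma wrank_le w s p q :
  weight_ordering w s -> (wrank s p < wrank s q)%N -> w p <= w q.
Proof.
case/andP=> /perm_mem ms; set leT := (X in sorted X _) => so lt_pq.
have leT_tr : transitive leT by move=> x y z; apply: le_trans.
by apply: (sorted_ltn_index leT_tr so) => //; rewrite ms mem_enum.
Qed.

End Perturbation.

Unset Implicit Arguments.

Theorem theorem1 (R : realFieldType) (d : Order.disp_t) (Q : finTBOrderType d)
    (w : Q -> R) (C : {set {set Q}}) (K : {set Q}) (s : seq Q)
    (w_ge0 : forall q : Q, 0 <= w q)
    (Q_covered : forall q : Q, exists2 c : {set Q}, c \in C & q \in c)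
    (s_ordering : weight_ordering w s)
    (feasible : exists T : tree Q, decision_tree C K T) :
  exists T : tree Q, minimum_cost w C K T /\ admissible_tree s C K T.
Proof.
(* Ranks start at one, so the perturbation also makes zero weights positive. *)
have [e e0 [T minT /cost_optimal optT]] :=
  perturbed_minimum w_ge0 (fun q => ler0n R (wrank s q)) feasible.
exists T; split=> //; apply: optimal_admissible optT.
- by move=> q; rewrite ltr_wpDl // mulr_gt0 // ltr0n.
- move=> p q pq; rewrite ler_ltD ?(wrank_le s_ordering) // ltr_pM2l //.
  by rewrite ltr_nat.
- exact: wrank_inj s_ordering.
Qed.
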